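(* Let $G\in\{\mathrm O(N),\mathrm{SP}(N)\}$, and let $n\ge1$ and $N\ge1$ be integers with $N\ge 2\times10^6\,n^{3/2}$. Then for every pairing $\pi\in\mathcal P_2(2n)$, $$\frac{N^{n+|\pi|}\,\mathrm{Wg}_N^{G}(\pi)}{\mathrm{Moeb}(\pi)}\le\frac{1}{(1-10^6 n^{3/2}/N)^2}.$$
   Context: $\mathcal P_2(2n)$ is the set of pairings (perfect matchings) of $[2n]=\{1,\dots,2n\}$; $\mathcal P_2(0)=\{\emptyset\}$. For $\sigma\in S_{2n}$ and $\pi=\{\{k_1,k_2\},\dots,\{k_{2n-1},k_{2n}\}\}$, $\sigma.\pi:=\{\{\sigma(k_1),\sigma(k_2)\},\dots,\{\sigma(k_{2n-1}),\sigma(k_{2n})\}\}$. Coset type: let $\mathcal G_\pi$ be the multigraph on vertex set $[2n]$ with an edge $\{2i-1,2i\}$ for each $i\in[n]$ and an edge $\{k,k'\}$ for each pair $\{k,k'\}\in\pi$. Its connected components have even sizes $2\lambda_1\ge\dots\ge2\lambda_l$; the partition $\lambda=(\lambda_1,\dots,\lambda_l)\vdash n$ is the coset type of $\pi$. Put $|\pi|:=n-l$ and $\mathrm{Moeb}(\pi):=(-1)^{|\pi|}\prod_{i=1}^l\mathrm{Cat}(\lambda_i-1)$, where $\mathrm{Cat}(k)=\frac{(2k)!}{k!(k+1)!}$. Orthogonal Weingarten graph: the directed graph with vertex set $\bigsqcup_{n\ge0}\mathcal P_2(2n)$. For $\pi_1,\pi_2\in\mathcal P_2(2n)$ there is a solid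 edge $\pi_1\to\pi_2$ if $\pi_2=(i\;\,2n-1).\pi_1$ for some $1\le i<2n-1$ (loops $\pi_1=\pi_2$ are allowed; they occur when $i$ is the partner of $2n-1$ in $\pi_1$). If $\pi\in\mathcal P_2(2n)$ contains the pair $\{2n-1,2n\}$, there is a dashed edge from $\pi$ to the element of $\mathcal P_2(2n-2)$ obtained by removing this pair. $\mathrm P(\pi,l)$ is the set of directed paths from $\pi$ to $\emptyset$ using exactly $l$ solid edges. For real $M$ with $|M|\ge2n$ and $\pi\in\mathcal P_2(2n)$, define $$\mathrm{Wg}_M^{\mathrm O}(\pi):=(-1)^{|\pi|}M^{-n-|\pi|}\sum_{g\ge0}|\mathrm P(\pi,|\pi|+g)|\,(-M)^{-g},$$ an absolutely convergent series. Then $\mathrm{Wg}_N^{\mathrm O(N)}:=\mathrm{Wg}_N^{\mathrm O}$, and the symplectic Weingarten function satisfies $\mathrm{Wg}_N^{\mathrm{SP}(N)}(\pi)=\pm\mathrm{Wg}_{-2N}^{\mathrm O}(\pi)$, with a sign that may depend on $\pi$; the claim is asserted for either sign. *)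

(* Defs.v *)
From HB Require Import structures.
From mathcomp Require Import all_boot all_order all_algebra all_fingroup.
From mathcomp Require Import finmap.
From mathcomp Require Import all_classical all_reals all_analysis.

Set Implicit Arguments.
Unset Strict Implicit.
Unset Printing Implicit Defensive.

Import Order.TTheory GRing.Theory Num.Theory.
Import numFieldNormedType.Exports.

Local Open Scope set_scope.

(* The points 1, ..., 2n are represented by the ordinals 0, ..., 2n - 1;
   in particular the point 2n - 1 is the ordinal of value 2n - 2. *)

Definition is_pairing n (P : {set {set 'I_n.*2}}) : bool :=
  finset.partition P [set: 'I_n.*2] && [forall B in P, #|B| == 2].

Record pairing n := Pairing {
  pairs :> {set {set 'I_n.*2}};
  pairsP : is_pairing pairs }.

HB.instance Definition _ n := [isSub for @pairs n].
HB.instance Definition _ n := [Finite of pairing n by <:].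

Definition map_pairs (T T' : finType) (f : T -> T') (P : {set {set T}}) :
  {set {set T'}} := [set f @: B | B : {set T} in P].

Definition coset_graph n (p : pairing n) : rel 'I_n.*2 :=
  fun x y => ((x != y) && (x./2 == y./2)) || ([set x; y] \in pairs p).

Definition components n (p : pairing n) : {set {set 'I_n.*2}} :=
  [set [set y | connect (coset_graph p) x y] | x : 'I_n.*2].

Definition coset_type n (p : pairing n) : seq nat :=
  sort geq [seq #|C|./2 | C : {set 'I_n.*2} <- enum (components p)].

Definition pnorm n (p : pairing n) : nat := n - size (coset_type p).

Definition solid_step n (p q : pairing n) : bool :=
  [exists i : 'I_n.*2, exists j : 'I_n.*2,
    [&& j.+2 == n.*2, i < j & pairs q == map_pairs (tperm i j) (pairs p)]].

(* The pair {2n + 1, 2n + 2} of the n.+1.*2 points. *)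
Definition last_pair n : {set 'I_n.+1.*2} := [set x : 'I_n.+1.*2 | n.*2 <= x].

Definition widen2 n : 'I_n.*2 -> 'I_n.+1.*2 :=
  widen_ord (leqW (leqnSn n.*2)).

Definition dashed_step n (p : pairing n.+1) (q : pairing n) : bool :=
  (last_pair n \in pairs p) &&
  (map_pairs (@widen2 n) (pairs q) == pairs p :\ last_pair n).

Definition vertex : Type := {n : nat & pairing n}.

Definition vtx n (p : pairing n) : vertex := existT pairing n p.

Definition solid_edge (u v : vertex) : bool :=
  let: existT n p := u in
  [exists q : pairing n, (v == vtx q) && solid_step p q].

Definition dashed_edge (u v : vertex) : bool :=
  match u with
  | existT 0 _ => false
  | existT n.+1 p => [exists q : pairing n, (v == vtx q) && dashed_step p q]
  end.

Definition edge (u v : vertex) : bool := solid_edge u v || dashed_edge u v.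

(* A directed path from u is given by the sequence s of the vertices following
   u. This loses nothing: distinct i give distinct pairings (i 2n-1).p, and an
   edge is solid or dashed according to the levels of its end points.
   tag (last u s) = 0 means that the path ends at the empty pairing, the only
   element of pairing 0. *)
Definition wpaths (u : vertex) (l : nat) : set (seq vertex) :=
  [set s | [&& path edge u s, tag (last u s) == 0
             & count id (pairmap solid_edge u s) == l]]%classic.

Lemma tag_solid_edge u v : solid_edge u v -> tag v = tag u.
Proof. by case: u => n p /existsP[q /andP[/eqP-> _]]. Qed.

Lemma tag_dashed_edge u v : dashed_edge u v -> tag u = (tag v).+1.
Proof. by case: u => [[|n] p] //= /existsP[q /andP[/eqP-> _]]. Qed.

Lemma finite_edges u : finite_set [set v | edge u v]%classic.
Proof.
apply: (@sub_finite_set _ _ (range (@vtx (tag u)) `|`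
                             range (@vtx (tag u).-1))%classic).
  move=> v /= /orP[/tag_solid_edge | /tag_dashed_edge] tuv.
    by left; rewrite -tuv; exists (tagged v) => //; case: v {tuv}.
  by right; rewrite tuv; exists (tagged v) => //; case: v {tuv}.
by rewrite finite_setU; split; apply: finite_image; exact: finite_finset.
Qed.

Lemma size_wpath u s : path edge u s ->
  size s <= count id (pairmap solid_edge u s) + tag u.
Proof.
elim: s u => //= v s IH u /andP[uv /IH].
case: (boolP (solid_edge u v)) => [/tag_solid_edge <-|nuv].
  by rewrite add1n addSn.
move: uv; rewrite /edge (negPf nuv) /= => /tag_dashed_edge ->.
by rewrite add0n addnS.
Qed.

Lemma finite_wpaths u l : finite_set (wpaths u l).
Proof.
suff fin m : forall w,
    finite_set [set s | path edge w s && (size s <= m)]%classic.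
  apply: sub_finite_set (fin (l + tag u) u) => s /= /and3P[us _ /eqP <-].
  by rewrite us size_wpath.
elim: m => [|m IH] w.
  apply: (@sub_finite_set _ _ [set [::]]%classic) => //.
  by move=> [|v s] //= /andP[_].
apply: (@sub_finite_set _ _ ([set [::]] `|` \bigcup_(v in [set v | edge w v])
    (cons v @` [set s | path edge v s && (size s <= m)]))%classic).
  move=> [|v s] /=; first by left.
  rewrite ltnS -andbA => /and3P[wv vs sm].
  by right; exists v => //; exists s => //=; rewrite vs.
rewrite finite_setU; split=> //; apply: bigcup_finite; first exact: finite_edges.
by move=> v _; exact: finite_image.
Qed.

Definition npaths n (p : pairing n) (l : nat) : nat :=
  #|` fset_set (wpaths (vtx p) l)|%fset.

Local Close Scope set_scope.
Local Open Scope ring_scope.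

Definition catalan (R : realType) (k : nat) : R :=
  (k.*2)`!%:R / (k`!%:R * (k.+1)`!%:R).

Definition moeb (R : realType) n (p : pairing n) : R :=
  (-1) ^+ pnorm p * \prod_(k <- coset_type p) catalan R k.-1.

Definition WgO (R : realType) (M : R) n (p : pairing n) : R :=
  (-1) ^+ pnorm p * M ^- (n + pnorm p) *
  limn (series (fun g => (npaths p (pnorm p + g))%:R * (- M) ^- g)).

(* SymplecticGroup with parameter N is SP(N), the group of 2N x 2N matrices. *)
Inductive compact_group := OrthogonalGroup | SymplecticGroup.

(* The sign (-1) ^+ eps p is the undetermined sign relating the symplectic
   Weingarten function to WgO (- 2N); it is irrelevant for the orthogonal
   group. *)
Definition Wg (R : realType) (G : compact_group) (N : nat)
    n (eps : pairing n -> bool) (p : pairing n) : R :=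
  match G with
  | OrthogonalGroup => WgO N%:R p
  | SymplecticGroup => (-1) ^+ eps p * WgO (- (2 * N%:R)) p
  end.

(* Main.v *)
(* Write s = 1/|M|.  Splitting off the first edge of a path shows that the
   generating function Z(p) = sum_l |P(p, l)| s^l is the least nonnegative
   solution of Z(p) = sum_(dashed p -> q) Z(q) + s sum_(solid p -> q) Z(q), so
   any V >= 0 with V(p) >= sum_(dashed) V(q) + s sum_(solid) V(q) bounds Z from
   above; this is enough, since only the absolute value of the alternating
   series has to be estimated.  If the component of the point 2n - 1 has size
   2k, the transpositions (i 2n-1) with i in that component split it into sizes
   2u, 2(k - u) (once for each 0 < u < k) or keep its size (k - 1 times), and
   those with i outside merge it with the component of i.  Hence
     V(p) = s^|p| prod_C g(|C|/2)  works as soon as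
     g(k) >= [k = 1] + sum_(0<u<k) g(u) g(k-u) + s (k-1) g(k) + 2 n s^2 4^k
   and g(k + r) <= 4^k g(r).  The choice g(k) = Cat(k-1) + 2 s 4^(k-1) does it
   when s n^(3/2) is small, because
     4^(k-1) - 2 sum_(0<u<k) Cat(u-1) 4^(k-u-1) = k Cat(k-1)
   dominates the remaining terms.  Finally 4^(k-1) <= 2 k sqrt(n) Cat(k-1), so
   prod_C g(|C|/2) <= prod_C Cat(|C|/2 - 1) / (1 - 4 s n^(3/2)). *)
Require Import Defs.
From HB Require Import structures.
From mathcomp Require Import all_boot all_order all_algebra all_fingroup.
From mathcomp Require Import zify ring lra.

Set Implicit Arguments.
Unset Strict Implicit.
Unset Printing Implicit Defensive.

Import Order.TTheory GRing.Theory Num.Theory.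

Local Open Scope set_scope.

(** * Components of the graph of two involutions *)

Section Components.
Variable T : finType.

Definition adj (a b : T -> T) : rel T := [rel x y | (y == a x) || (y == b x)].
Definition comp (a b : T -> T) (x : T) : {set T} :=
  [set y | connect (adj a b) x y].

(* The walk x, a x, b (a x), ... around the component of x; it is closed, and
   its last step before returning to x is a b-edge. *)
Fixpoint zigzag (a b : T -> T) (x : T) t : T :=
  if t is t'.+1 then (if odd t' then b else a) (zigzag a b x t') else x.

Lemma zigzag_connect (e : rel T) a b x lo hi :
  (forall t, lo <= t < hi -> e (zigzag a b x t) (zigzag a b x t.+1)) ->
  forall t, lo <= t <= hi -> connect e (zigzag a b x lo) (zigzag a b x t).
Proof.
move=> step t /andP[lot thi].
rewrite -(subnK lot) in thi *; elim: (t - lo) thi => [|d IH] thi.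
  by rewrite add0n connect0.
rewrite addSn; apply: connect_trans (IH (ltnW thi)) (connect1 _).
by apply: step; rewrite leq_addl.
Qed.

Section Involutions.
Variables a b : T -> T.
Hypotheses (aK : involutive a) (bK : involutive b).

Lemma adj_connect_sym : connect_sym (adj a b).
Proof.
apply: sym_connect_sym => x y /=.
rewrite /adj /= -[y == a x](inj_eq (inv_inj aK)) aK.
by rewrite -[y == b x](inj_eq (inv_inj bK)) bK ![_ == x]eq_sym.
Qed.

Lemma comp_id x : x \in comp a b x.
Proof. by rewrite inE connect0. Qed.

Lemma comp_transl x y : y \in comp a b x -> comp a b y = comp a b x.
Proof.
rewrite inE => xy; apply/setP => z; rewrite !inE.
by rewrite (same_connect adj_connect_sym xy).
Qed.

Lemma comp_a x y : y \in comp a b x -> a y \in comp a b x.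
Proof.
rewrite !inE => xy; apply: connect_trans xy (connect1 _).
by rewrite /adj /= eqxx.
Qed.

Lemma comp_b x y : y \in comp a b x -> b y \in comp a b x.
Proof.
rewrite !inE => xy; apply: connect_trans xy (connect1 _).
by rewrite /adj /= eqxx orbT.
Qed.

(** A set closed under both involutions is a union of components, and reachability from [x] leaves
    only one. The components after a swap are all identified this way. *)
Lemma comp_char (S : {set T}) x :
  x \in S -> (forall y, y \in S -> a y \in S) ->
  (forall y, y \in S -> b y \in S) ->
  (forall y, y \in S -> connect (adj a b) x y) ->
  forall z, z \in S -> comp a b z = S.
Proof.
move=> xS aS bS conn; suff compx : comp a b x = S.
  by move=> z zS; rewrite -compx; apply: comp_transl; rewrite compx.
apply/setP => y; rewrite inE; apply/idP/idP => [xy|/conn //].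
have cS : closed (adj a b) S.
  apply: intro_closed; first exact: adj_connect_sym.
  move=> u v /orP[]/eqP->; first exact: aS.
  exact: bS.
by rewrite -(closed_connect cS xy).
Qed.

End Involutions.

(** * The closed walk around a component *)

Section FixedPointFree.
Variables a b : T -> T.
Hypotheses (aK : involutive a) (bK : involutive b).
Hypotheses (a_neq : forall x, a x != x) (b_neq : forall x, b x != x).

Local Notation zig := (zigzag a b).

(** The rotation [b \o a] advances the walk by two positions, so its orbit is every second point of
    the component; [card_comp] confirms the name. *)
Definition half_size x := fingraph.order (b \o a) x.

Let ba_inj : injective (b \o a).
Proof. exact: inj_comp (inv_inj bK) (inv_inj aK). Qed.

Lemma zigzag_double x u : zig x u.*2 = iter u (b \o a) x.
Proof. by elim: u => //= u ->; rewrite odd_double. Qed.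

Lemma zigzag_even x t : ~~ odd t -> zig x t.+1 = a (zig x t).
Proof. by move=> /negbTE /= ->. Qed.

Lemma zigzag_odd x t : odd t -> zig x t.+1 = b (zig x t).
Proof. by move=> /= ->. Qed.

Lemma zigzag_half_size x : zig x (half_size x).*2 = x.
Proof. by rewrite zigzag_double iter_order. Qed.

Lemma half_size_gt0 x : 0 < half_size x.
Proof. exact: fingraph.order_gt0. Qed.

(* a and b are reflections inverting the rotation b \o a; a fixed point of any
   reflection of the dihedral group yields one of a or of b. *)
Lemma reflection_neq t x : a x != iter t (b \o a) x.
Proof.
elim/ltn_ind: t x => -[_ x|[_ x|t IH x]]; first exact: a_neq.
  by rewrite /= eq_sym b_neq.
rewrite iterSr /=; have /(_ (b (a x))) := IH t (leqnSn _).
apply: contraNneq => /(congr1 b); rewrite bK => /(congr1 a).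
by rewrite aK => ->.
Qed.

(** Even positions form the orbit of the rotation, odd ones its image under [a]. Within a class the
    order of the rotation separates the positions; across the classes [reflection_neq] does. *)
Lemma zigzag_inj x t t' : t < (half_size x).*2 -> t' < (half_size x).*2 ->
  zig x t = zig x t' -> t = t'.
Proof.
have iter_inj u v : u < half_size x -> v < half_size x ->
    iter u (b \o a) x = iter v (b \o a) x -> u = v.
  by move=> ltu ltv e; rewrite -(findex_iter ltu) e findex_iter.
have odd_even u v : a (iter u (b \o a) x) <> iter v (b \o a) x.
  case: (leqP u v) => [leuv|/ltnW levu].
    by rewrite -(subnK leuv) iterD => /eqP; rewrite (negPf (reflection_neq _ _)).
  rewrite -(subnK levu) iterD => /(congr1 a); rewrite aK => /esym/eqP.
  by rewrite (negPf (reflection_neq _ _)).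
rewrite -(odd_double_half t) -(odd_double_half t').
case: (odd t); case: (odd t'); rewrite ?add0n ?add1n /= ?odd_double ?zigzag_double.
- rewrite !ltn_Sdouble => ltu ltv /(congr1 a); rewrite !aK => e.
  by rewrite (iter_inj _ _ _ _ e).
- by move=> _ _ /odd_even.
- by move=> _ _ /esym /odd_even.
- by rewrite !ltn_double => ltu ltv e; rewrite (iter_inj _ _ _ _ e).
Qed.

Lemma b_zigzag0 x : b x = zig x (half_size x).*2.-1.
Proof.
rewrite -{1}(zigzag_half_size x).
by have := half_size_gt0 x; case: (half_size x) => // k _ /=; rewrite odd_double bK.
Qed.

Lemma b_zigzag_even x t : 0 < t -> ~~ odd t -> b (zig x t) = zig x t.-1.
Proof. by case: t => // t _ /=; rewrite negbK => ->; rewrite bK. Qed.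

Lemma a_zigzag_odd x t : odd t -> a (zig x t) = zig x t.-1.
Proof. by case: t => // t /= /negbTE->; rewrite aK. Qed.

Lemma zigzag_comp x t : zig x t \in comp a b x.
Proof.
elim: t => [|t IH] /=; first exact: comp_id.
by case: odd; [exact: comp_b | exact: comp_a].
Qed.

(** The walk returns to [x] by a [b]-step from an odd position, so the set of its points is stable
    under both involutions. *)
Lemma compP x y :
  reflect (exists2 t, t < (half_size x).*2 & y = zig x t) (y \in comp a b x).
Proof.
apply: (iffP idP) => [|[t _ ->]]; last exact: zigzag_comp.
pose S := [set zig x t | t : 'I_(half_size x).*2].
have inS t : t < (half_size x).*2 -> zig x t \in S.
  by move=> ltt; apply/imsetP; exists (Ordinal ltt).
suff -> : comp a b x = S by move=> /imsetP[t _ ->]; exists t.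
have x0 : 0 < (half_size x).*2 by rewrite double_gt0 half_size_gt0.
have xS : x \in S := inS 0 x0.
apply: (comp_char aK bK xS) => // _ /imsetP[[t ltt] _ /= ->].
- case ot: (odd t); first by rewrite a_zigzag_odd // inS // (leq_ltn_trans (leq_pred _)).
  rewrite -zigzag_even ?ot //; move: ltt; rewrite leq_eqVlt => /orP[/eqP e|/inS //].
  by have := odd_double (half_size x); rewrite -e /= ot.
- case ot: (odd t).
    rewrite -zigzag_odd //; move: ltt; rewrite leq_eqVlt => /orP[/eqP ->|/inS //].
    by rewrite zigzag_half_size.
  case: (posnP t) => [->|t0].
    by rewrite b_zigzag0 inS // prednK.
  by rewrite b_zigzag_even ?ot // inS // (leq_ltn_trans (leq_pred _)).
- have := zigzag_comp x t; rewrite inE; exact.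
Qed.

Lemma uniq_zigzag x m n : m + n <= (half_size x).*2 ->
  uniq [seq zig x t | t <- iota m n].
Proof.
move=> le; rewrite map_inj_in_uniq ?iota_uniq // => t t'.
rewrite !mem_iota => /andP[_ lt] /andP[_ lt']; apply: zigzag_inj.
  exact: leq_trans lt le.
exact: leq_trans lt' le.
Qed.

Definition zigzag_set x n : {set T} := [set z in [seq zig x t | t <- iota 0 n]].

Lemma zigzag_setP x n z :
  reflect (exists2 t, t < n & z = zig x t) (z \in zigzag_set x n).
Proof.
rewrite inE; apply: (iffP mapP) => -[t lt ->]; exists t => //.
  by move: lt; rewrite mem_iota.
by rewrite mem_iota.
Qed.

Lemma card_zigzag_set x n : n <= (half_size x).*2 -> #|zigzag_set x n| = n.
Proof.
move=> le; rewrite cardsE; have /card_uniqP -> := @uniq_zigzag x 0 n le.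
by rewrite size_map size_iota.
Qed.

Lemma comp_zigzag_set x : comp a b x = zigzag_set x (half_size x).*2.
Proof. by apply/setP => y; apply/compP/zigzag_setP. Qed.

Lemma card_comp x : #|comp a b x| = (half_size x).*2.
Proof. by rewrite comp_zigzag_set card_zigzag_set. Qed.

End FixedPointFree.
End Components.

(** * Effect of a transposition on the components *)

Section Swap.
Variables (T : finType) (a b : T -> T).
Hypotheses (aK : involutive a) (bK : involutive b).
Hypotheses (a_neq : forall x, a x != x) (b_neq : forall x, b x != x).

(* The involution of the pairing (i j).p, where b is that of p. *)
Definition swap (i j z : T) : T := tperm i j (b (tperm i j z)).

Local Notation zig := (zigzag a b).
Local Notation half := (half_size a b).

Lemma swapK i j : involutive (swap i j).
Proof. by move=> z; rewrite /swap tpermK bK tpermK. Qed.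

Lemma swap_closed i j (S : {set T}) :
  (forall y, y \in S -> b y \in S) -> (i \in S) = (j \in S) ->
  forall y, y \in S -> swap i j y \in S.
Proof.
move=> bS ijS; have tS z : z \in S -> tperm i j z \in S.
  by case: tpermP => // ->; rewrite ijS.
by move=> y yS; rewrite !(tS, bS).
Qed.

Lemma swap_eq i j z : z != i -> z != j -> b z != i -> b z != j ->
  swap i j z = b z.
Proof. by move=> zi zj bi bj; rewrite /swap !tpermD // eq_sym. Qed.

Lemma swap_i i j : b i != j -> swap i j j = b i.
Proof. by move=> bij; rewrite /swap tpermR tpermD // 1?eq_sym. Qed.

Lemma swap_zigzag_step i j x t :
  (odd t -> [&& zig x t != i, zig x t != j, zig x t.+1 != i & zig x t.+1 != j]) ->
  adj a (swap i j) (zig x t) (zig x t.+1).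
Proof.
rewrite /adj /=; case: (odd t) => [/(_ isT)/and4P[ti tj bi bj]|_]; last by rewrite eqxx.
by rewrite swap_eq // eqxx orbT.
Qed.

Lemma comp_swap_closed i j x : i \notin comp a b x -> j \notin comp a b x ->
  comp a (swap i j) x = comp a b x.
Proof.
move=> iC jC; apply: (comp_char aK (swapK i j) (comp_id a b x)).
- exact: comp_a.
- by apply: swap_closed; [exact: comp_b | rewrite (negPf iC) (negPf jC)].
- move=> y /(compP aK bK)[t _ ->].
  apply: (@zigzag_connect _ _ a b x 0 t) => [u _|]; last by rewrite leqnn.
  apply: swap_zigzag_step => _.
  have := zigzag_comp a b x u; have := zigzag_comp a b x u.+1.
  move: (zig x u) (zig x u.+1) => y1 y2 y2C y1C.
  by apply/and4P; split; [move: iC|move: jC|move: iC|move: jC]; apply: contraNneq => <-.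
- exact: comp_id.
Qed.


Lemma swap_bi i j : b i != j -> swap i j (b i) = j.
Proof.
by move=> bij; rewrite /swap [tperm i j (b i)]tpermD ?bK ?tpermL // eq_sym.
Qed.

(** The swap disturbs only [b]-edges with an end at [i] or [j]. Since [lo] is even, the walk leaves
    [zig x lo] along an [a]-edge, so this starting point may itself be [i] or [j]. *)
Lemma swap_zigzag_connect i j x lo hi :
  (forall t, lo < t <= hi -> (zig x t != i) && (zig x t != j)) -> ~~ odd lo ->
  forall t, lo <= t <= hi ->
  connect (adj a (swap i j)) (zig x lo) (zig x t).
Proof.
move=> avoid elo; apply: zigzag_connect => t /andP[lot thi].
apply: swap_zigzag_step => ot.
have /andP[-> ->] : (zig x t != i) && (zig x t != j).
  by apply: avoid; rewrite (ltnW thi) andbT ltn_neqAle lot andbT;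
     apply: contraNneq elo => ->.
by apply: avoid; rewrite thi ltnS lot.
Qed.

Section SameComponent.
Variables (j : T).
Local Notation k := (half j).

Let zig_eq t t' : t < k.*2 -> t' < k.*2 -> (zig j t == zig j t') = (t == t').
Proof.
move=> lt lt'; apply/eqP/eqP => [|-> //].
exact: (zigzag_inj aK bK a_neq b_neq lt lt').
Qed.

(** At an odd position of [i], unless [i = b j], the edges {j, b j} and {i, b i} give way to {j, b
    i} and {i, b j}: the arc after [i] is reattached in reverse and the cycle stays whole. *)
Lemma comp_swap_twist u : 0 < u < k ->
  comp a (swap (zig j u.*2.+1) j) j = comp a b j.
Proof.
move=> /andP[u0 uk]; set i := zig _ _.
have u2k : u.*2.+1 < k.*2 by rewrite ltn_Sdouble.
have j0 : j = zig j 0 by [].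
apply: (comp_char aK (swapK i j) (comp_id a b j)); last exact: comp_id.
- exact: comp_a.
- by apply: swap_closed; [exact: comp_b | rewrite comp_id zigzag_comp].
move=> y /(compP aK bK)[t ltt ->]; case: (leqP t u.*2) => [letu|].
  apply: (@swap_zigzag_connect i j j 0 u.*2) => // v /andP[v0 lev].
  rewrite [X in (_ != i) && (_ != X)]j0 /i !zig_eq; lia.
rewrite leq_eqVlt => /orP[/eqP <-|ltu].
  have := @swap_zigzag_connect i j j 0 u.*2 _ isT u.*2.
  rewrite leqnn => /(_ _ isT) conn; apply: connect_trans (conn _) (connect1 _).
    move=> v /andP[v0 lev].
    rewrite [X in (_ != i) && (_ != X)]j0 /i !zig_eq; lia.
  by rewrite /adj /i /= odd_double eqxx.
(* A position beyond 2u + 1 exists here, which excludes [i = b j]; the new edge {j, b i} then leads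
   directly to position 2u + 2. *)
have bi : b i = zig j u.*2.+2 by rewrite -zigzag_odd //= odd_double.
have bij : b i != j by rewrite bi [X in _ != X]j0 zig_eq; lia.
apply: connect_trans (_ : connect _ _ (zig j u.*2.+2)) _.
  by apply: connect1; rewrite /adj /= -/(zig j u.*2.+2) -bi swap_i // eqxx orbT.
apply: (@swap_zigzag_connect i j j u.*2.+2 t); last by rewrite leqnn andbT.
  move=> v /andP[v0 lev].
  rewrite [X in (_ != i) && (_ != X)]j0 /i !zig_eq; lia.
by rewrite /= negbK odd_double.
Qed.

(** At an even position 2u of [i], the point [b i] is at 2u - 1, so the new edge {j, b i} closes the
    arc of positions below 2u into a cycle, and {i, b j} closes the remaining arc. *)
Lemma comp_swap_split u (S := zigzag_set a b j u.*2) : 0 < u < k ->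
  (forall z, z \in S -> comp a (swap (zig j u.*2) j) z = S) /\
  (forall z, z \in comp a b j :\: S ->
     comp a (swap (zig j u.*2) j) z = comp a b j :\: S).
Proof.
move=> /andP[u0 uk]; set i := zig _ _; set sw := swap i j.
have u2k : u.*2 < k.*2 by rewrite ltn_double.
have u20 : 0 < u.*2 by rewrite double_gt0.
have j0 : j = zig j 0 by [].
have inS t : t < u.*2 -> zig j t \in S.
  by move=> ltt; apply/zigzag_setP; exists t.
have bi : b i = zig j u.*2.-1 by rewrite b_zigzag_even // odd_double.
have bij : b i != j by rewrite bi [X in _ != X]j0 zig_eq; lia.
have aS y : y \in S -> a y \in S.
  move=> /zigzag_setP[t ltt ->]; case ot: (odd t).
    by rewrite a_zigzag_odd // inS // (leq_ltn_trans (leq_pred _)).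
  by rewrite -zigzag_even ?ot // inS //; lia.
have swS y : y \in S -> sw y \in S.
  move=> /zigzag_setP[t ltt ->]; case: (posnP t) => [->|t0].
    by rewrite /= /sw swap_i // bi inS // prednK.
  have [tu|tu] := eqVneq t u.*2.-1.
    by rewrite tu -bi /sw swap_bi // [j]j0 inS.
  have bt : b (zig j t) = zig j (if odd t then t.+1 else t.-1).
    case: ifP => ot; first by rewrite -zigzag_odd.
    by rewrite b_zigzag_even ?ot.
  rewrite /sw swap_eq ?bt; last 4 first.
  - by rewrite /i zig_eq; lia.
  - by rewrite [X in _ != X]j0 zig_eq; lia.
  - by case: ifP => ot; rewrite /i zig_eq; lia.
  - by case: ifP => ot; rewrite [X in _ != X]j0 zig_eq; lia.
  by apply: inS; case: ifP => ot; lia.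
have aC y : y \in comp a b j :\: S -> a y \in comp a b j :\: S.
  rewrite 2!in_setD => /andP[yS yC]; apply/andP; split; last exact: comp_a.
  by apply: contra yS => /aS; rewrite aK.
have swC y : y \in comp a b j :\: S -> sw y \in comp a b j :\: S.
  rewrite 2!in_setD => /andP[yS yC]; apply/andP; split.
    by apply: contra yS => /swS; rewrite /sw swapK.
  apply: swap_closed yC; first exact: comp_b.
  by rewrite comp_id zigzag_comp.
split.
  apply: (comp_char aK (swapK i j) (inS 0 u20) aS swS).
  move=> y /zigzag_setP[t ltt ->].
  apply: (@swap_zigzag_connect i j j 0 u.*2.-1) => // [v|]; last by lia.
  move=> /andP[v0 lev]; rewrite [X in (_ != i) && (_ != X)]j0 /i !zig_eq; lia.
have iC : i \in comp a b j :\: S.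
  rewrite inE zigzag_comp andbT; apply/zigzag_setP => -[t ltt /eqP].
  by rewrite /i zig_eq; lia.
apply: (comp_char aK (swapK i j) iC aC swC).
move=> y; rewrite inE => /andP[yS /(compP aK bK)[t ltt ytE]].
have leut : u.*2 <= t.
  by rewrite leqNgt; apply: contra yS => ltu; rewrite ytE inS.
rewrite ytE; apply: (@swap_zigzag_connect i j j u.*2 t).
- move=> v /andP[v0 lev].
  rewrite [X in (_ != i) && (_ != X)]j0 /i !zig_eq; lia.
- by rewrite odd_double.
- by rewrite leqnn andbT.
Qed.

End SameComponent.

(** One [b]-edge is cut in each of the two cycles, and the new edges {j, b i} and {i, b j} join the
    open ends crosswise. *)
Lemma comp_swap_merge i j : i \notin comp a b j ->
  forall z, z \in comp a b i :|: comp a b j ->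
  comp a (swap i j) z = comp a b i :|: comp a b j.
Proof.
move=> iCj; set sw := swap i j.
have jCi : j \notin comp a b i.
  by move: iCj; rewrite !inE (adj_connect_sym aK bK).
have bij : b i != j by apply: contraNneq jCi => <-; exact/comp_b/comp_id.
have uniq0 x v : 0 < v < (half x).*2 -> zig x v != x.
  move=> /andP[v0 lev]; apply: contra_neq (lt0n_neq0 v0) => e.
  by apply: (zigzag_inj aK bK a_neq b_neq lev) => //; exact: leq_ltn_trans lev.
have conn_j y : y \in comp a b j -> connect (adj a sw) j y.
  move=> /(compP aK bK)[t ltt ->].
  apply: (@swap_zigzag_connect i j j 0 t) => // [v /andP[v0 lev]|]; last first.
    by rewrite leqnn.
  rewrite uniq0 ?v0 ?(leq_ltn_trans lev) // andbT.
  by apply: contraNneq iCj => <-; exact: zigzag_comp.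
have conn_i y : y \in comp a b i -> connect (adj a sw) i y.
  move=> /(compP aK bK)[t ltt ->].
  apply: (@swap_zigzag_connect i j i 0 t) => // [v /andP[v0 lev]|]; last first.
    by rewrite leqnn.
  rewrite uniq0 ?v0 ?(leq_ltn_trans lev) //=.
  by apply: contraNneq jCi => <-; exact: zigzag_comp.
have conn_ji : connect (adj a sw) j i.
  apply: connect_trans (_ : connect _ _ (b i)) _.
    by apply: connect1; rewrite /adj /= /sw swap_i // eqxx orbT.
  rewrite (adj_connect_sym aK (swapK i j)); apply: conn_i.
  exact/comp_b/comp_id.
apply: (@comp_char _ a sw aK (swapK i j) _ j).
- by rewrite inE comp_id orbT.
- by move=> y /setUP[] yC; apply/setUP; [left|right]; exact: comp_a.
- apply: swap_closed; last by rewrite !inE !connect0 !orbT.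
  by move=> y /setUP[] yC; apply/setUP; [left|right]; exact: comp_b.
- by move=> y /setUP[/conn_i|/conn_j //]; exact: connect_trans.
Qed.

End Swap.

(** * Weights of components *)

Local Open Scope ring_scope.

(** Groups the positions of a walk from 2 on: the even one of each couple will split the component,
    the odd one will twist it. *)
Lemma sum_pairs (V : nmodType) (F : nat -> V) m :
  \sum_(t <- iota 2 m.*2) F t = \sum_(u < m) (F u.+1.*2 + F u.+1.*2.+1).
Proof.
elim: m => [|m IH]; first by rewrite big_ord0 big_nil.
rewrite big_ord_recr -IH [in iota _ _]doubleS -[m.*2.+2]addn2 iotaD big_cat /=.
by rewrite !big_cons big_nil addr0 add2n.
Qed.

Section ComponentWeight.
Variables (R : realFieldType) (w : nat -> R) (T : finType) (a : T -> T).
Hypothesis w_gt0 : forall k, 0 < w k.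

(** The index is a set of components, so each counts once however many of its points lie in [B]. *)
Definition comp_prod (b : T -> T) (B : {set T}) : R :=
  \prod_(S in [set comp a b x | x in B]) w #|S|./2.

Lemma comp_prod_gt0 b B : 0 < comp_prod b B.
Proof. exact: prodr_gt0. Qed.

Lemma eq_comp_prod b b' (B : {set T}) :
  (forall x, x \in B -> comp a b x = comp a b' x) ->
  comp_prod b B = comp_prod b' B.
Proof. by move=> e; rewrite /comp_prod (eq_in_imset e). Qed.

Lemma comp_prodD b (A B : {set T}) x : x \in A -> A \subset B ->
  (forall z, z \in A -> comp a b z = A) ->
  comp_prod b B = w #|A|./2 * comp_prod b (B :\: A).
Proof.
move=> xA AB compA; rewrite /comp_prod.
have -> : [set comp a b z | z in B] = A |: [set comp a b z | z in B :\: A].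
  apply/setP => S; rewrite !inE; apply/imsetP/orP => [[z zB ->]|[/eqP->|/imsetP[z]]].
  - case: (boolP (z \in A)) => zA; first by left; rewrite compA.
    by right; apply/imsetP; exists z; rewrite // inE zA.
  - by exists x; rewrite ?compA // (subsetP AB).
  - by rewrite inE => /andP[_ zB] ->; exists z.
rewrite big_setU1 //; apply/imsetP => -[z]; rewrite inE => /andP[/negP zA _] eA.
by apply: zA; rewrite eA comp_id.
Qed.

Variable b : T -> T.
Hypotheses (aK : involutive a) (bK : involutive b).
Hypotheses (a_neq : forall x, a x != x) (b_neq : forall x, b x != x).
Hypothesis w_grow : forall k r, (0 < r)%N -> w (k + r) <= 4 ^+ k * w r.

Local Notation half := (half_size a b).

Lemma comp_prod_setT j :
  comp_prod b setT = w (half j) * comp_prod b (~: comp a b j).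
Proof.
rewrite (comp_prodD (comp_id a b j) (subsetT _)).
  by rewrite (card_comp aK bK a_neq b_neq) doubleK setTD.
by move=> z; exact: comp_transl.
Qed.

Lemma comp_prod_swap (i j : T) (A : {set T}) :
  (i \in A) -> (j \in A) -> (forall x y, x \notin A -> y \in comp a b x -> y \notin A) ->
  comp_prod (swap b i j) (~: A) = comp_prod b (~: A).
Proof.
move=> iA jA cA; apply: eq_comp_prod => x; rewrite inE => xA.
by apply: comp_swap_closed => //; apply/negP => /(cA _ _ xA); rewrite ?iA ?jA.
Qed.

Let notin_comp j x y :
  x \notin comp a b j -> y \in comp a b x -> y \notin comp a b j.
Proof.
move=> xj yx; apply: contra xj => yj.
by rewrite -(comp_transl aK bK yj) (comp_transl aK bK yx) comp_id.
Qed.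

Lemma comp_prod_twist j u : (0 < u < half j)%N ->
  comp_prod (swap b (zigzag a b j u.*2.+1) j) setT =
  w (half j) * comp_prod b (~: comp a b j).
Proof.
move=> uk; set i := zigzag _ _ _ _.
rewrite (@comp_prodD _ (comp a b j) _ j (comp_id _ _ _) (subsetT _)).
  rewrite (card_comp aK bK a_neq b_neq) doubleK setTD comp_prod_swap //.
  - exact: zigzag_comp.
  - exact: comp_id.
  - exact: notin_comp.
move=> z zC; have e := comp_swap_twist aK bK a_neq b_neq uk.
by rewrite -e; apply: (comp_transl aK (swapK bK _ _)); rewrite e.
Qed.

Lemma comp_prod_split j u : (0 < u < half j)%N ->
  comp_prod (swap b (zigzag a b j u.*2) j) setT =
  w u * w (half j - u) * comp_prod b (~: comp a b j).
Proof.
move=> uk; have [compS compCS] := comp_swap_split aK bK a_neq b_neq uk.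
case/andP: (uk) => u0 ltuk; set S := zigzag_set a b j u.*2 in compS compCS.
set i := zigzag _ _ _ _ in compS compCS *.
have cS : #|S| = u.*2.
  by rewrite /S (card_zigzag_set aK bK a_neq b_neq) // leq_double ltnW.
have SC : S \subset comp a b j.
  by apply/subsetP => z /zigzag_setP[t _ ->]; exact: zigzag_comp.
have jS : j \in S by apply/zigzag_setP; exists 0 => //; rewrite double_gt0.
have iCS : i \in comp a b j :\: S.
  rewrite inE zigzag_comp andbT; apply/zigzag_setP => -[t ltt].
  have ltuk2 : (u.*2 < (half j).*2)%N by rewrite ltn_double.
  move=> /(zigzag_inj aK bK a_neq b_neq ltuk2 (ltn_trans ltt ltuk2)) e.
  by rewrite e ltnn in ltt.
rewrite (comp_prodD jS (subsetT _) compS) cS doubleK.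
rewrite (comp_prodD iCS _ compCS); last by
  rewrite setTD setDE; apply/subsetP => z; rewrite !inE => /andP[].
rewrite cardsD (setIidPr SC) cS (card_comp aK bK a_neq b_neq) -doubleB doubleK.
have -> : [set: T] :\: S :\: (comp a b j :\: S) = ~: comp a b j.
  apply/setP => z; rewrite !inE andbT; have := subsetP SC z; rewrite !inE.
  by case: (z \in [seq _ | _ <- _]) => [->|_] //=; rewrite ?andbT.
rewrite mulrA comp_prod_swap //.
- exact: zigzag_comp.
- exact: comp_id.
- exact: notin_comp.
Qed.

(** The merged component has half size [half i + half j]; [w_grow] trades its weight for 4 ^+
    [half j] times the weight of the old component of [i], which restores the product away from
    [j]. *)
Lemma comp_prod_merge i j : i \notin comp a b j ->
  comp_prod (swap b i j) setT <= 4 ^+ half j * comp_prod b (~: comp a b j).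
Proof.
move=> iC; have iU : i \in comp a b i :|: comp a b j by rewrite inE comp_id.
have dis : [disjoint comp a b i & comp a b j].
  rewrite -setI_eq0; apply/eqP/setP => z; rewrite in_setI in_set0.
  by apply/negP => /andP[/(notin_comp iC)/negP].
rewrite (comp_prodD iU (subsetT _) (comp_swap_merge aK bK a_neq b_neq iC)).
have iCC : comp a b i \subset ~: comp a b j by rewrite -disjoints_subset.
rewrite (comp_prodD (comp_id a b i) iCC); last by move=> z; exact: comp_transl.
rewrite setTD comp_prod_swap //; last 2 first.
- by rewrite inE comp_id orbT.
- by move=> x y; rewrite !in_setU !negb_or => /andP[xi xj] yx; rewrite (notin_comp xi yx) (notin_comp xj yx).
have -> : ~: comp a b j :\: comp a b i = ~: (comp a b i :|: comp a b j).
  by rewrite setDE -setCU setUC.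
rewrite mulrA ler_pM2r ?comp_prod_gt0 //.
rewrite cardsU (eqP (_ : _ :&: _ == set0)) ?setI_eq0 // cards0 subn0.
rewrite !(card_comp aK bK a_neq b_neq) -doubleD !doubleK addnC.
by apply: w_grow; exact: half_size_gt0.
Qed.

(** Excluding [j] and [a j] removes positions 0 and 1 of the walk. The other even positions split
    the component, the odd ones keep it, and the at most [#|T|] points outside merge with it. *)
Lemma sum_comp_prod_swap j :
  \sum_(i | (i != j) && (i != a j)) comp_prod (swap b i j) setT <=
  (\sum_(u < (half j).-1) w u.+1 * w ((half j).-1 - u) +
   (half j).-1%:R * w (half j) + #|T|%:R * 4 ^+ half j) *
  comp_prod b (~: comp a b j).
Proof.
set k := half j; set m := k.-1; set P0 := comp_prod b _.
have km : k = m.+1 by rewrite /m prednK // half_size_gt0.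
rewrite (bigID (mem (comp a b j))) /= mulrDl lerD //.
  set s := [seq zigzag a b j t | t <- iota 2 m.*2].
  have us : uniq s by rewrite uniq_zigzag // -/k km doubleS add2n.
  rewrite (eq_bigl (mem s)) => [|i].
    rewrite -big_uniq //= big_map sum_pairs.
    have -> : (\sum_(u < m) w u.+1 * w (m - u) + m%:R * w k) * P0 =
        \sum_(u < m) (w u.+1 * w (m - u) * P0 + w k * P0).
      by rewrite big_split /= sumr_const card_ord -mulr_suml; ring.
    rewrite le_eqVlt; apply/orP; left; apply/eqP; apply: eq_bigr => u _.
    have uk : (0 < u.+1 < k)%N by rewrite km !ltnS ltn_ord.
    by rewrite comp_prod_split ?comp_prod_twist // -/k km subSS.
  have j0 : j = zigzag a b j 0 by [].
  have aj : a j = zigzag a b j 1 by [].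
  apply/idP/mapP => [/andP[/andP[ij iaj] /(compP aK bK)[t ltt itE]]|[t]].
    exists t => //; rewrite mem_iota add2n -doubleS -km ltt andbT.
    by case: t itE {ltt} => [|[|t]] // itE; rewrite itE ?eqxx in ij iaj.
  rewrite mem_iota add2n -doubleS -km => /andP[t2 ltt] ->.
  rewrite zigzag_comp andbT [X in (_ != X) && _]j0 aj.
  by apply/andP; split; apply/eqP => /(zigzag_inj aK bK a_neq b_neq) e;
     have := e ltt; rewrite -/k km doubleS => /(_ isT) e'; rewrite e' in t2.
apply: le_trans (_ : \sum_(i | (i != j) && (i != a j) && (i \notin comp a b j)) 4 ^+ k * P0 <= _).
  by apply: ler_sum => i /andP[_ iC]; exact: comp_prod_merge.
rewrite sumr_const -[leLHS]mulr_natl -[leRHS]mulrA ler_wpM2r //.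
  by rewrite mulr_ge0 ?exprn_ge0 //; exact: ltW (comp_prod_gt0 _ _).
by rewrite ler_nat max_card.
Qed.
End ComponentWeight.

(** * Pairings as involutions *)

Section Embedding.
Variables (T T' : finType) (h : T -> T') (a b : T -> T) (a' b' : T' -> T').
Hypotheses (h_inj : injective h) (aK : involutive a') (bK : involutive b').
Hypotheses (ha : forall x, a' (h x) = h (a x)).
Hypotheses (hb : forall x, b' (h x) = h (b x)).

(** Serves the dashed edges, where [widen2] embeds the smaller point set and intertwines both
    involutions. *)
Lemma comp_imset x : comp a' b' (h x) = h @: comp a b x.
Proof.
apply: (comp_char aK bK (imset_f h (comp_id a b x))); last exact/imset_f/comp_id.
- by move=> _ /imsetP[y yC ->]; rewrite ha; exact/imset_f/comp_a.
- by move=> _ /imsetP[y yC ->]; rewrite hb; exact/imset_f/comp_b.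
move=> _ /imsetP[y + ->]; rewrite inE => /connectP[p + ->].
elim: p x => [|z p IH] x /=; first by rewrite connect0.
move=> /andP[xz /IH]; apply: connect_trans; apply: connect1.
by case/orP: xz => /eqP ->; rewrite /adj /= -?ha -?hb eqxx ?orbT.
Qed.

Lemma comp_prod_imset (R : realFieldType) (w : nat -> R) (B : {set T}) :
  comp_prod w a' b' (h @: B) = comp_prod w a b B.
Proof.
rewrite /comp_prod.
have -> : [set comp a' b' x | x in h @: B] =
          [set h @: (S : {set T}) | S in [set comp a b x | x in B]].
  by rewrite -!imset_comp; apply: eq_imset => x /=; rewrite comp_imset.
rewrite big_imset /=; last by move=> S S' _ _; exact: imset_inj.
by apply: eq_bigr => S _; rewrite card_imset.
Qed.

End Embedding.

Lemma eq_comp (T : finType) (a b b' : T -> T) : b =1 b' -> comp a b =1 comp a b'.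
Proof.
move=> e x; apply/setP => y; rewrite !inE; apply: eq_connect => u v.
by rewrite /adj /= e.
Qed.

Section Partner.
Variable n : nat.
Implicit Types (p q : pairing n) (x y : 'I_n.*2).

Fact mate_subproof x : ((if odd x then x.-1 else x.+1) < n.*2)%N.
Proof.
case: ifP => ox; first exact: leq_ltn_trans (leq_pred _) (ltn_ord x).
by have := ltn_ord x; lia.
Qed.

(** The other end of the fixed edge {2i - 1, 2i}; counting from 0, such an edge joins an even value
    to its successor. *)
Definition mate x : 'I_n.*2 := Ordinal (mate_subproof x).

Lemma mateK : involutive mate.
Proof.
move=> x; apply: val_inj => /=; case ox: (odd x) => /=; last by rewrite ox.
by case: (val x) ox => //= m /negbTE ->.
Qed.

Lemma mate_neq x : mate x != x.
Proof. by rewrite -val_eqE /=; case: ifP => ox; case: (val x) ox => /=; lia. Qed.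

Lemma mateE x y : (y == mate x) = (x != y) && (x./2 == y./2).
Proof. by rewrite -!val_eqE /=; case: ifP => ox; lia. Qed.

(** The default [x] is never returned, since every point lies in some pair ([partner_mem]). *)
Definition partner p x : 'I_n.*2 := odflt x [pick y | [set x; y] \in pairs p].

Let pair_card p (S : {set 'I_n.*2}) : S \in pairs p -> #|S| = 2.
Proof. by move=> Sp; have /andP[_ /forall_inP/(_ _ Sp)/eqP] := pairsP p. Qed.

Lemma partner_mem p x : [set x; partner p x] \in pairs p.
Proof.
rewrite /partner; case: pickP => [y|no] //.
have /andP[/and3P[/eqP cov _ _] _] := pairsP p.
have : x \in finset.cover (pairs p) by rewrite cov inE.
move=> /bigcupP[S Sp xS]; have /eqP/cards2P[u [v [uv SE]]] := pair_card Sp.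
move: xS Sp; rewrite SE !inE => /orP[]/eqP xE Sp.
  by have := no v; rewrite xE Sp.
by have := no u; rewrite xE setUC Sp.
Qed.

Lemma partner_neq p x : partner p x != x.
Proof.
have := pair_card (partner_mem p x); rewrite cards2 eq_sym.
by case: eqP.
Qed.

Lemma partner_eq p x y : [set x; y] \in pairs p -> partner p x = y.
Proof.
move=> xyp; have /andP[/and3P[_ triv _] _] := pairsP p.
have e : [set x; y] = [set x; partner p x].
  by apply/eqP; apply: contraTT isT => ne;
    have /disjoint_setI0/setP/(_ x) :=
      trivIsetP triv _ _ xyp (partner_mem p x) ne; rewrite !inE eqxx.
have : partner p x \in [set x; y] by rewrite e !inE eqxx orbT.
by rewrite !inE (negPf (partner_neq p x)) => /eqP.
Qed.

Lemma partnerK p : involutive (partner p).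
Proof. by move=> x; apply: partner_eq; rewrite setUC partner_mem. Qed.

Lemma coset_graphE p : coset_graph p =2 adj mate (partner p).
Proof.
move=> x y; rewrite /coset_graph /adj /= mateE; congr (_ || _).
by apply/idP/eqP => [/partner_eq //|->]; exact: partner_mem.
Qed.

Lemma componentsE p : components p = [set comp mate (partner p) x | x in setT].
Proof.
apply/setP => S; apply/imsetP/imsetP => -[x _ ->]; exists x => //;
  by apply/setP => y; rewrite !inE (eq_connect (coset_graphE p)).
Qed.

Lemma partner_map_tperm p q i j :
  pairs q = map_pairs (tperm i j) (pairs p) -> partner q =1 swap (partner p) i j.
Proof.
move=> qE x; apply: partner_eq; rewrite qE /swap.
set y := partner p _.
have -> : [set x; tperm i j y] = tperm i j @: [set tperm i j x; y].
  by rewrite imsetU !imset_set1 tpermK.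
exact/imset_f/partner_mem.
Qed.

End Partner.

(** * Sums over the solid and dashed successors of a pairing *)

Section Steps.
Variables (R : realFieldType) (w : nat -> R).
Hypothesis w_gt0 : forall k, 0 < w k.
Hypothesis w_grow : forall k r, (0 < r)%N -> w (k + r) <= 4 ^+ k * w r.

Definition pair_prod n (p : pairing n) : R :=
  comp_prod w (@mate n) (partner p) setT.

Lemma pair_prod_gt0 n (p : pairing n) : 0 < pair_prod p.
Proof. exact: comp_prod_gt0. Qed.

Lemma big_unique (I : finType) (P : pred I) (F : I -> R) (c : R) : 0 <= c ->
  (forall x y, P x -> P y -> x = y) -> (forall x, P x -> F x <= c) ->
  \sum_(x | P x) F x <= c.
Proof.
move=> c0 uni le; case: (pickP P) => [x Px|no]; last by rewrite big_pred0.
rewrite (big_pred1 x) ?le // => y.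
by apply/idP/eqP => [Py|-> //]; exact: uni.
Qed.

Variable n : nat.
Implicit Type p : pairing n.+1.

(* The point 2n - 1 of the paper (n being n.+1 here). *)
Fact marked_subproof : (n.*2 < n.+1.*2)%N. Proof. by rewrite doubleS ltnS. Qed.
Definition marked : 'I_n.+1.*2 := Ordinal marked_subproof.

(** Each solid successor is charged to an index [i] producing it, and each [i] produces at most one.
    An index below [marked] differs from [marked] and from its mate, the last point. *)
Lemma sum_solid_step p :
  \sum_(q : pairing n.+1 | solid_step p q) pair_prod q <=
  \sum_(i | (i != marked) && (i != mate marked))
     comp_prod w (@mate n.+1) (swap (partner p) i marked) setT.
Proof.
apply: le_trans (_ : \sum_(q : pairing n.+1)
  \sum_(i | (i != marked) && (i != mate marked))
    (if pairs q == map_pairs (tperm i marked) (pairs p) then pair_prod q else 0) <= _).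
  rewrite [leLHS]big_mkcond ler_sum // => q _; case: ifP => [|_]; last first.
    by apply: sumr_ge0 => i _; case: ifP => // _; exact/ltW/pair_prod_gt0.
  move=> /existsP[i /existsP[j /and3P[/eqP jn ij qE]]].
  have jE : j = marked.
    by apply: val_inj => /=; lia.
  rewrite jE in ij qE; rewrite (bigD1 i) /=.
    rewrite qE lerDl; apply: sumr_ge0 => k _; case: ifP => // _.
    exact/ltW/pair_prod_gt0.
  rewrite -!val_eqE /= odd_double; move: ij => /=; lia.
rewrite exchange_big ler_sum //= => i _; rewrite -big_mkcond.
apply: big_unique => [|q q' /eqP qE /eqP q'E|q /eqP qE].
- exact/ltW/comp_prod_gt0.
- by apply: val_inj; rewrite /= qE q'E.
- rewrite le_eqVlt; apply/orP; left; apply/eqP; apply: eq_comp_prod => x _.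
  exact/eq_comp/partner_map_tperm.
Qed.

Let half p := half_size (@mate n.+1) (partner p) marked.
Let rest p := comp_prod w (@mate n.+1) (partner p)
  (~: comp (@mate n.+1) (partner p) marked).

Lemma widen2_inj : injective (@widen2 n).
Proof. by move=> x y /(congr1 val) /= e; apply: val_inj. Qed.

Lemma last_pairE : last_pair n = [set marked; mate marked].
Proof.
apply/setP => x; rewrite !inE -!val_eqE /= odd_double.
by have := ltn_ord x; lia.
Qed.

(** A dashed edge requires the last pair to lie in [p]; then [mate] and [partner] agree at [marked],
    whose component is that pair alone, and removing it leaves the other factors intact. *)
Lemma sum_dashed_step p :
  \sum_(q : pairing n | dashed_step p q) pair_prod q <=
  (half p == 1%N)%:R * rest p.
Proof.
apply: big_unique => [|q q' /andP[_ /eqP qE] /andP[_ /eqP q'E]|q].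
- by rewrite mulr_ge0 // ltW // comp_prod_gt0.
- apply: val_inj; apply: (imset_inj (imset_inj widen2_inj)).
  by rewrite -[LHS]/(map_pairs _ _) qE -q'E.
move=> /andP[lastp /eqP qE].
set j := marked; set a := @mate n.+1; set b := partner p.
have aK : involutive a := @mateK _; have bK : involutive b := partnerK p.
have bj : b j = a j by apply: partner_eq; rewrite -last_pairE.
have compj : comp a b j = [set j; a j].
  apply: (comp_char aK bK _ _ _ _ (set21 _ _)) => [|x|x|x].
  - exact: set21.
  - by rewrite !inE => /orP[]/eqP->; rewrite ?aK eqxx ?orbT.
  - by rewrite !inE => /orP[]/eqP->; rewrite ?bj -?bj ?bK eqxx ?orbT.
  - rewrite !inE => /orP[]/eqP->; first exact: connect0.
    by apply: connect1; rewrite /adj /= eqxx.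
have halfj : half p = 1%N.
  apply: double_inj; rewrite -(card_comp aK bK (@mate_neq _) (partner_neq p)).
  by rewrite compj cards2 eq_sym mate_neq.
rewrite halfj eqxx mul1r /rest -/a -/b -/j.
have -> : ~: comp a b j = @widen2 n @: setT.
  rewrite compj -last_pairE; apply/setP => x; rewrite !inE -ltnNge.
  apply/idP/imsetP => [ltx|[y _ ->]]; last exact: (ltn_ord y).
  by exists (Ordinal ltx) => //; apply: val_inj.
rewrite (@comp_prod_imset _ _ (@widen2 n) (@mate n) (partner q)) //.
- exact: widen2_inj.
- by move=> x; apply: val_inj.
- move=> x; apply: partner_eq.
  have -> : [set widen2 x; widen2 (partner q x)] = @widen2 n @: [set x; partner q x].
    by rewrite imsetU !imset_set1.
  have : @widen2 n @: [set x; partner q x] \in pairs p :\ last_pair n.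
    by rewrite -qE; exact/imset_f/partner_mem.
  by rewrite inE => /andP[].
Qed.

Lemma half_marked p :
  (0 < half p <= n.+1)%N /\ pair_prod p = w (half p) * rest p.
Proof.
split; last first.
  apply: comp_prod_setT;
    [exact: mateK | exact: partnerK | exact: mate_neq | exact: partner_neq].
rewrite half_size_gt0 -leq_double.
rewrite -(card_comp (@mateK _) (partnerK p) (@mate_neq _) (partner_neq p)).
by have := max_card (mem (comp (@mate n.+1) (partner p) marked)); rewrite card_ord.
Qed.

(** The inequality for V on level n + 1, with V = s^n [pair_prod] on level n, divided by s^(n+1). A
    dashed edge lowers the level, whence [s^-1]; in the hypothesis [m.+1] is the half size of the
    component of [marked]. *)
Lemma sum_steps (s : R) p : 0 < s ->
  (forall m, (m < n.+1)%N ->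
    s ^-1 * (m == 0)%:R + s * (\sum_(u < m) w u.+1 * w (m - u) + m%:R * w m.+1 +
         (2 * n.+1%:R) * 4 ^+ m.+1) <= w m.+1) ->
  s ^-1 * (\sum_(q : pairing n | dashed_step p q) pair_prod q) +
  s * (\sum_(q : pairing n.+1 | solid_step p q) pair_prod q) <= pair_prod p.
Proof.
move=> s0 super; have [/andP[k0 kn] ->] := half_marked p.
apply: le_trans (_ : s^-1 * ((half p == 1%N)%:R * rest p) + s *
  ((\sum_(u < (half p).-1) w u.+1 * w ((half p).-1 - u) +
   (half p).-1%:R * w (half p) + #|'I_n.+1.*2|%:R * 4 ^+ half p) * rest p) <= _).
  apply: lerD; first by rewrite ler_pM2l ?invr_gt0 // sum_dashed_step.
  rewrite ler_pM2l //; apply: le_trans (sum_solid_step p) _.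
  exact: (sum_comp_prod_swap w_gt0 (@mateK _) (partnerK p) (@mate_neq _) (partner_neq p) w_grow).
rewrite !mulrA -mulrDl ler_pM2r ?comp_prod_gt0 //.
case: (half p) k0 kn => // m _ ltm; rewrite card_ord -mul2n natrM /= eqSS.
exact: super.
Qed.

End Steps.

Local Close Scope set_scope.

From mathcomp Require Import finmap.
From mathcomp Require Import all_classical all_reals all_analysis.
Import numFieldNormedType.Exports.

(** * Catalan numbers *)

Section CatalanNumbers.
Variable R : realType.
Local Notation cat := (catalan R).

Lemma catalan0 : cat 0 = 1.
Proof. by rewrite /catalan fact0 (_ : 1`! = 1)%N // mulr1 divr1. Qed.

Lemma catalanS k : k.+2%:R * cat k.+1 = 2 * (2 * k%:R + 1) * cat k.
Proof.
rewrite /catalan doubleS !factS !natrM.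
have fn0 m : m`!%:R != 0 :> R by rewrite pnatr_eq0 -lt0n fact_gt0.
have := fn0 k; have := fn0 k.*2; rewrite -mul2n.
have -> : k.+2%:R = k%:R + 2 :> R by rewrite -natrD addn2.
have -> : k.+1%:R = k%:R + 1 :> R by rewrite natr1.
have -> : (2 * k).+2%:R = 2 * k%:R + 2 :> R by rewrite -natrM -natrD addn2.
have -> : (2 * k).+1%:R = 2 * k%:R + 1 :> R by rewrite -natrM natr1.
have k0 : 0 <= k%:R :> R by [].
move: (k%:R) (_`!%:R) (_`!%:R) k0 => x f d x0 _ f0.
by field; rewrite f0 /=; apply/andP; split; lra.
Qed.

Lemma catalan_gt0 k : 0 < cat k.
Proof. by rewrite divr_gt0 ?mulr_gt0 // ltr0n fact_gt0. Qed.

Lemma catalanS_le k : cat k.+1 <= 4 * cat k.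
Proof.
have k0 : 0 < k.+2%:R :> R by [].
rewrite -(ler_pM2l k0) catalanS; have := catalan_gt0 k.
have -> : k.+2%:R = k%:R + 2 :> R by rewrite -natrD addn2.
by move=> c0; nra.
Qed.

(* Gosper's antidifference of the terms of the Catalan convolution. *)
Let gosper i j : R := i.+1%:R * cat i * (j.+1%:R * cat j) * (i%:R - j%:R) /
  (2 * (i + j)%:R * (i + j).+1%:R).

Lemma gosper_diff i j : gosper i.+1 j - gosper i j.+1 = cat i * cat j.
Proof.
rewrite /gosper addSn addnS !catalanS.
have i0 : 0 <= i%:R :> R by []. have j0 : 0 <= j%:R :> R by [].
have -> : (i + j).+2%:R = i%:R + j%:R + 2 :> R by rewrite -!natrD addn2.
have -> : (i + j).+1%:R = i%:R + j%:R + 1 :> R by rewrite -natrD natr1.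
have -> : i.+1%:R = i%:R + 1 :> R by rewrite natr1.
have -> : j.+1%:R = j%:R + 1 :> R by rewrite natr1.
by field; apply/andP; split; lra.
Qed.

(** The sum telescopes along i + j = n + 1, and each of the two end values of [gosper] contributes
    half of Cat(n + 1). *)
Lemma catalan_conv n : \sum_(i < n.+1) cat i * cat (n - i) = cat n.+1.
Proof.
rewrite -(big_mkord xpredT (fun i => cat i * cat (n - i))).
rewrite (eq_big_nat _ _ (F2 := fun i => gosper i.+1 (n.+1 - i.+1) -
  gosper i (n.+1 - i))); last first.
  by move=> i /andP[_ lti]; rewrite subSS subSn // gosper_diff.
rewrite (telescope_sumr (fun i => gosper i (n.+1 - i))) // subn0 subnn.
rewrite /gosper addn0 add0n catalan0.
have n0 : 0 <= n%:R :> R by [].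
have -> : n.+2%:R = n%:R + 2 :> R by rewrite -natrD addn2.
have -> : n.+1%:R = n%:R + 1 :> R by rewrite natr1.
by field; apply/andP; split; lra.
Qed.

(** Passing to m + 1 multiplies the old sum by 4 and adds Cat(m); then 4 (m + 1) Cat(m) - 2 Cat(m) =
    (m + 2) Cat(m + 1) by [catalanS]. *)
Lemma catalan_geom_conv m :
  2 * (\sum_(i < m) cat i * 4 ^+ (m.-1 - i)) = 4 ^+ m - m.+1%:R * cat m.
Proof.
elim: m => [|m IH]; first by rewrite big_ord0 catalan0; ring.
rewrite big_ord_recr /= subnn expr0 mulr1 catalanS.
have -> : \sum_(i < m) cat i * 4 ^+ (m - i) =
          4 * \sum_(i < m) cat i * 4 ^+ (m.-1 - i).
  rewrite mulr_sumr; apply: eq_bigr => i _.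
  have -> : (m - i = (m.-1 - i).+1)%N by have := ltn_ord i; lia.
  by rewrite exprS; ring.
rewrite mulrDr mulrCA IH exprS.
have -> : m.+1%:R = m%:R + 1 :> R by rewrite natr1.
by ring.
Qed.

(** Here (m + 1) Cat(m) is the central binomial coefficient of 2m. In the induction step the slack
    is exactly the square (2 Cat(m))^2. *)
Lemma central_binomial_lower m :
  16 ^+ m <= (4 * m%:R + 1) * (m.+1%:R * cat m) ^+ 2.
Proof.
elim: m => [|m IH]; first by rewrite catalan0 expr0; lra.
rewrite catalanS exprS; move: IH.
have -> : m.+1%:R = m%:R + 1 :> R by rewrite natr1.
have : 0 <= m%:R :> R by [].
move: (m%:R) (cat m) (16 ^+ m) => x c e x0 le_e.
apply: le_trans (_ : 16 * ((4 * x + 1) * ((x + 1) * c) ^+ 2) <= _).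
  by rewrite ler_pM2l.
by rewrite -subr_ge0 (_ : _ - _ = (2 * c) ^+ 2); [exact: sqr_ge0 | ring].
Qed.

(** Square root of the previous bound, with [q] the root of n and 4m + 1 <= 4n = (2q)^2. *)
Lemma expr4_le n m (q : R) : 0 <= q -> q ^+ 2 = n%:R -> (m < n)%N ->
  4 ^+ m <= 2 * q * (m.+1%:R * cat m).
Proof.
move=> q0 qn ltmn; have c0 : 0 <= m.+1%:R * cat m by rewrite pmulr_rge0 // ltW // catalan_gt0.
rewrite -(@ler_pXn2r _ 2) ?nnegrE ?exprn_ge0 // ?(mulr_ge0 _ c0) ?mulr_ge0 //.
rewrite -exprM mulnC exprM (_ : 4 ^+ 2 = 16); last by ring.
apply: le_trans (central_binomial_lower m) _.
rewrite [leRHS]exprMn [in leRHS]exprMn qn ler_wpM2r ?sqr_ge0 //.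
have : m.+1%:R <= n%:R :> R by rewrite ler_nat.
by rewrite -natr1; lra.
Qed.

(** * The weight g(k) and its recursive inequality *)

Section Weight.
Variable s : R.
Hypothesis s_ge0 : 0 <= s.

(* Meaningful for k > 0 only. *)
Definition cweight k : R := cat k.-1 + 2 * s * 4 ^+ k.-1.

Lemma cweight_gt0 k : 0 < cweight k.
Proof.
by rewrite ltr_pwDl ?catalan_gt0 // !mulr_ge0 // exprn_ge0.
Qed.

Lemma cweightD_le k r : (0 < r)%N -> cweight (k + r) <= 4 ^+ k * cweight r.
Proof.
case: r => // r _; elim: k => [|k IH]; first by rewrite expr0 mul1r.
rewrite exprS -mulrA; apply: le_trans (_ : 4 * cweight (k + r.+1) <= _).
  rewrite addSn !addnS /cweight /= exprS.
  by have := catalanS_le (k + r); lra.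
by rewrite ler_pM2l.
Qed.

(** For m > 0 the Catalan products sum to Cat(m), the two equal mixed sums give 2 s 4^m minus the
    gain 2 s (m + 1) Cat(m), and the geometric products give the last term. For m = 0 the indicator
    supplies Cat(0). *)
Lemma cweight_conv m :
  (m == 0)%:R + \sum_(u < m) cweight u.+1 * cweight (m - u) =
  cweight m.+1 - 2 * s * (m.+1%:R * cat m) + 4 * s ^+ 2 * (m%:R * 4 ^+ m.-1).
Proof.
case: m => [|m].
  by rewrite big_ord0 /cweight /= catalan0; ring.
rewrite /cweight /= add0r.
have -> : \sum_(u < m.+1) (cat u + 2 * s * 4 ^+ u) *
    (cat (m.+1 - u).-1 + 2 * s * 4 ^+ (m.+1 - u).-1) =
  \sum_(u < m.+1) (cat u * cat (m - u)) +
  2 * s * (\sum_(u < m.+1) cat u * 4 ^+ (m - u)) +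
  2 * s * (\sum_(u < m.+1) cat (m - u) * 4 ^+ u) +
  4 * s ^+ 2 * \sum_(u < m.+1) 4 ^+ m.
  rewrite !mulr_sumr -!big_split /=; apply: eq_bigr => u _.
  have leum : (u <= m)%N by rewrite -ltnS.
  rewrite subSn //= -[in X in _ = _ + X](subnKC leum) exprD; ring.
have -> : \sum_(u < m.+1) cat (m - u) * 4 ^+ u =
          \sum_(u < m.+1) cat u * 4 ^+ (m - u).
  rewrite [RHS](reindex_inj rev_ord_inj); apply: eq_bigr => u _ /=.
  by rewrite subSS subKn // -ltnS.
have := catalan_geom_conv m.+1; rewrite /= => e.
rewrite catalan_conv sumr_const card_ord -mulr_natl.
move: e; move: (\sum_(_ < _) _) => S e.
have -> : 4 ^+ m.+1 = 2 * S + m.+2%:R * cat m.+1 by rewrite e subrK.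
ring.
Qed.

(** The gain 2 s D, where D = (m + 1) Cat(m), has to pay for everything else: s m Cat(m) takes at
    most half of it, and the terms of order s^2 fit into the other half since 4^m <= 2 q D. *)
Lemma cweight_supersolution n (q : R) m :
  0 <= q -> q ^+ 2 = n%:R -> 2 * 10 ^+ 6 * (n%:R * q * s) <= 1 -> (m < n)%N ->
  (m == 0)%:R + \sum_(u < m) cweight u.+1 * cweight (m - u) +
    s * (m%:R * cweight m.+1) + s ^+ 2 * (2 * n%:R * 4 ^+ m.+1) <=
  cweight m.+1.
Proof.
move=> q0 qn small ltmn; rewrite cweight_conv.
have le4 := expr4_le q0 qn ltmn.
have mn : m%:R <= n%:R :> R by rewrite ler_nat ltnW.
have m0 : 0 <= m%:R :> R by [].
have c0 := catalan_gt0 m.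
have : 0 <= m.+1%:R * cat m by rewrite pmulr_rge0 // ltW.
set D := m.+1%:R * cat m in le4 * => D0.
have le_mc : m%:R * cat m <= D.
  by rewrite /D -natr1 ler_pM2r // lerDl.
have nqD : 0 <= n%:R * (2 * q * D) by rewrite mulr_ge0 // mulr_ge0 // mulr_ge0.
have le4' : m%:R * 4 ^+ m.-1 * 4 <= n%:R * (2 * q * D).
  case: (m) mn le4 => [_ _|k mn le4]; first by rewrite !mul0r.
  by rewrite -mulrA -exprSr ler_pM // exprn_ge0.
rewrite /cweight /=.
have e0 : 0 <= 4 ^+ m :> R by rewrite exprn_ge0.
have leM : m%:R * 4 ^+ m <= n%:R * (2 * q * D) by apply: ler_pM.
have leN : n%:R * 4 ^+ m <= n%:R * (2 * q * D) by apply: ler_wpM2l.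
rewrite [4 ^+ m.+1]exprS.
set P := m%:R * 4 ^+ m.-1 in le4' *.
have s2 : 0 <= s ^+ 2 by exact: sqr_ge0.
have := ler_wpM2l s2 le4'; have := ler_wpM2l s2 leM.
have := ler_wpM2l s2 leN; have := ler_wpM2l s_ge0 le_mc.
(* 22 = 2 + 4 + 16 collects, in units of n q s^2 D, the geometric convolution, the geometric part of
   s m g(m + 1), and the merging term. *)
have : 22 * (s * D) * (n%:R * q * s) <= s * D.
  have sD : 0 <= s * D by exact: mulr_ge0.
  have : 0 <= n%:R * q * s by rewrite !mulr_ge0.
  move: (n%:R * q * s) (s * D) sD small => t z z0 small t0.
  nra.
move=> h1 h2 h3 h4 h5.
lra.
Qed.

End Weight.
End CatalanNumbers.

(** * Counting paths *)

Lemma npaths_le n (p : pairing n) l (r : seq (seq vertex)) :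
  (forall t, wpaths (vtx p) l t -> t \in r) -> (npaths p l <= size r)%N.
Proof.
move=> sub; rewrite /npaths; apply: uniq_leq_size; first exact: fset_uniq.
move=> t.
by rewrite in_fset_set ?inE; [exact: sub | exact: finite_wpaths].
Qed.

Lemma wpaths_enum n (p : pairing n) l t : wpaths (vtx p) l t ->
  t \in enum_fset (fset_set (wpaths (vtx p) l)).
Proof.
move=> pt; have : t \in fset_set (wpaths (vtx p) l) by rewrite in_fset_set ?inE //; exact: finite_wpaths.
by [].
Qed.

Lemma npaths0 (p : pairing 0) l : (npaths p l <= (l == 0))%N.
Proof.
apply: leq_trans (npaths_le (r := nseq (l == 0) [::]) _) _; last by rewrite size_nseq.
move=> [|v t] /and3P[/= + _ /eqP <-] //.
by move=> /andP[/orP[/existsP[q /andP[_ /existsP[[]]]]|]].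
Qed.

(** The first edge is dashed and keeps [l], or solid and lowers it. For an upper bound it is enough
    that the list [r1 ++ r2] contains every path. *)
Lemma npathsS n (p : pairing n.+1) l : (npaths p l <=
  \sum_(q : pairing n | dashed_step p q) npaths q l +
  (if l is l'.+1 then \sum_(q : pairing n.+1 | solid_step p q) npaths q l' else 0))%N.
Proof.
pose ext k (q : pairing k) l := [seq vtx q :: t | t <- enum_fset (fset_set (wpaths (vtx q) l))].
have size_ext k (q : pairing k) l' : size (ext k q l') = npaths q l'.
  by rewrite size_map.
pose r1 := flatten [seq ext _ q l | q <- enum {: pairing n} & dashed_step p q].
pose r2 := if l is l'.+1 then
  flatten [seq ext _ q l' | q <- enum {: pairing n.+1} & solid_step p q] else [::].
apply: leq_trans (npaths_le (r := r1 ++ r2) _) _; last first.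
  rewrite size_cat leq_add //.
    rewrite size_flatten sumnE !big_map big_filter big_enum_cond.
    by rewrite leq_eqVlt; apply/orP; left; apply/eqP; apply: eq_bigr => q _.
  rewrite /r2; case: (l) => // l'.
  rewrite size_flatten sumnE !big_map big_filter big_enum_cond.
  by rewrite leq_eqVlt; apply/orP; left; apply/eqP; apply: eq_bigr => q _.
move=> [|v t] /and3P[] //= /andP[pv vt] lt0.
rewrite mem_cat; move: pv; rewrite /edge.
case: (boolP (solid_edge _ _)) => [sv _|nsv /= dv] /eqP cl0;
  have cl : (solid_edge (vtx p) v + count id (pairmap solid_edge v t))%N = l := cl0;
  apply/orP.
  right; move: cl; rewrite sv add1n /r2 => <-; move: sv => /existsP[q /andP[/eqP vq pq]].
  apply/flatten_mapP; exists q; first by rewrite mem_filter pq mem_enum.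
  rewrite vq; apply: map_f; apply: wpaths_enum.
  by rewrite -vq; apply/and3P; split.
left; move: cl; rewrite (negPf nsv) add0n => cl; move: dv => /existsP[q /andP[/eqP vq pq]].
apply/flatten_mapP; exists q; first by rewrite mem_filter pq mem_enum.
rewrite vq; apply: map_f; apply: wpaths_enum.
by rewrite -vq -cl; apply/and3P; split.
Qed.

(** * The coset type as the list of half sizes of components *)

Section CosetType.
Variable n : nat.
Implicit Type p : pairing n.

Lemma perm_coset_type p :
  perm_eq (coset_type p) [seq #|C|./2 | C : {set 'I_n.*2} <- enum (components p)].
Proof. by rewrite perm_sort. Qed.

Lemma pair_prodE (R : realFieldType) (w : nat -> R) p :
  pair_prod w p = \prod_(k <- coset_type p) w k.
Proof.
rewrite (perm_big _ (perm_coset_type p)) /= big_map big_enum.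
by rewrite /pair_prod /comp_prod -componentsE.
Qed.

Lemma half_card_component p C : C \in components p ->
  (0 < #|C|./2)%N /\ #|C| = (#|C|./2).*2.
Proof.
rewrite componentsE => /imsetP[x _ ->].
rewrite (card_comp (@mateK _) (partnerK p) (@mate_neq _) (partner_neq p)).
by rewrite doubleK half_size_gt0.
Qed.

Lemma coset_type_gt0 p k : k \in coset_type p -> (0 < k)%N.
Proof.
rewrite (perm_mem (perm_coset_type p)) => /mapP[C]; rewrite mem_enum => Cp ->.
by have [] := half_card_component Cp.
Qed.

Lemma sumn_coset_type p : (\sum_(k <- coset_type p) k <= n)%N.
Proof.
rewrite (perm_big _ (perm_coset_type p)) /= big_map big_enum /= -leq_double.
have -> : ((\sum_(C in components p) #|C|./2).*2 = \sum_(C in components p) #|C|)%N.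
  rewrite -mul2n big_distrr /=; apply: eq_bigr => C /half_card_component[_ {2}->].
  by rewrite mul2n.
have /eqP -> : finset.trivIset (components p).
  apply/finset.trivIsetP => A B.
  rewrite componentsE => /imsetP[x _ ->] /imsetP[y _ ->].
  apply: contraR => /pred0Pn[z /andP[zx zy]].
  by rewrite -(comp_transl (@mateK _) (partnerK p) zx) -(comp_transl (@mateK _) (partnerK p) zy).
by apply: leq_trans (max_card _) _; rewrite card_ord.
Qed.

(** Ensures that the subtraction in [pnorm] is not truncated. *)
Lemma size_coset_type p : (size (coset_type p) <= n)%N.
Proof.
apply: leq_trans (sumn_coset_type p); rewrite -sum1_size big_seq [leqRHS]big_seq.
by apply: leq_sum => k /coset_type_gt0.
Qed.

End CosetType.

(** * The supersolution bounds the generating function of paths *)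

Section PathBound.
Variables (R : realType) (s q : R) (n0 : nat).
Hypotheses (s_gt0 : 0 < s) (q_ge0 : 0 <= q) (q2 : q ^+ 2 = n0%:R).
Hypothesis small : 2 * 10 ^+ 6 * (n0%:R * q * s) <= 1.

(** One division by [s] per component makes s^n times the product of these weights equal to s^|p|
    times the product of [cweight], as |p| is n minus the number of components. *)
Let w k : R := cweight s k / s.

Let w_gt0 k : 0 < w k.
Proof. by rewrite divr_gt0 // cweight_gt0 // ltW. Qed.

Let w_grow k r : (0 < r)%N -> w (k + r) <= 4 ^+ k * w r.
Proof.
by move=> r0; rewrite mulrA ler_pM2r ?invr_gt0 // cweightD_le // ltW.
Qed.

(** Multiplied by [s], this is [cweight_supersolution]. The weight depends on the top level [n0]
    through [small] only, so it serves every lower level that a path visits. *)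
Let w_super n m : (n < n0)%N -> (m < n.+1)%N ->
  s ^-1 * (m == 0%N)%:R + s * (\sum_(u < m) w u.+1 * w (m - u) + m%:R * w m.+1 +
     (2 * n.+1%:R) * 4 ^+ m.+1) <= w m.+1.
Proof.
move=> nn0 mn; rewrite /w ler_pdivlMr //.
have := cweight_supersolution (ltW s_gt0) q_ge0 q2 small (leq_trans mn nn0).
apply: le_trans.
have -> : \sum_(u < m) cweight s u.+1 / s * (cweight s (m - u) / s) =
   (\sum_(u < m) cweight s u.+1 * cweight s (m - u)) / s ^+ 2.
  by rewrite mulr_suml; apply: eq_bigr => u _; field; rewrite gt_eqF.
have le4 : 2 * n.+1%:R * 4 ^+ m.+1 <= 2 * n0%:R * 4 ^+ m.+1 :> R.
  by rewrite ler_pM2r ?exprn_gt0 // ler_pM2l // ler_nat.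
have s2 : 0 <= s ^+ 2 by exact: sqr_ge0.
have := ler_wpM2l s2 le4; set S := \sum_(_ < _) _.
set B := 2 * _ * _; set D := 2 * _ * _; move=> leBD.
rewrite (_ : _ * s = (m == 0%N)%:R + S + s * (m%:R * cweight s m.+1) + s ^+ 2 * B); last first.
  by field; rewrite gt_eqF.
by rewrite lerD2l.
Qed.

(** Double induction following the first edge: a dashed edge lowers the level [n], a solid one
    lowers the truncation [L] at the same level. *)
Lemma npaths_sum_le n (p : pairing n) L : (n <= n0)%N ->
  \sum_(l < L) (npaths p l)%:R * s ^+ l <= s ^+ n * pair_prod w p.
Proof.
elim: n p L => [|n IHn] p L lenn.
  have -> : pair_prod w p = 1.
    rewrite pair_prodE; have := size_coset_type p.
    by rewrite leqn0 => /eqP/size0nil ->; rewrite big_nil.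
  rewrite expr0 mulr1; case: L => [|L]; first by rewrite big_ord0.
  rewrite big_ord_recl /= expr0 mulr1 big1 ?addr0.
    by rewrite (le_trans (_ : _ <= 1%N%:R)) // ler_nat; exact: (npaths0 p 0).
  by move=> l _; have := npaths0 p l.+1; rewrite leqn0 => /eqP ->; rewrite mul0r.
elim: L p => [|L IHL] p.
  by rewrite big_ord0 mulr_ge0 ?exprn_ge0 // ltW // pair_prod_gt0.
apply: le_trans (_ : s ^+ n.+1 *
  (s ^-1 * (\sum_(r : pairing n | dashed_step p r) pair_prod w r) +
   s * (\sum_(r : pairing n.+1 | solid_step p r) pair_prod w r)) <= _); last first.
  by rewrite ler_pM2l ?exprn_gt0 //; apply: sum_steps => // m; exact: w_super.
have -> x y : s ^+ n.+1 * (s^-1 * x + s * y) = s ^+ n * x + s * (s ^+ n.+1 * y).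
  by rewrite exprS; field; rewrite gt_eqF.
rewrite mulr_sumr [in X in _ + s * X]mulr_sumr.
apply: le_trans (_ : \sum_(l < L.+1) (\sum_(r : pairing n | dashed_step p r)
     (npaths r l)%:R * s ^+ l) +
   s * \sum_(l < L) (\sum_(r : pairing n.+1 | solid_step p r)
     (npaths r l)%:R * s ^+ l) <= _); last first.
  rewrite exchange_big [in X in _ + s * X <= _]exchange_big /=.
  apply: lerD; first by apply: ler_sum => r _; apply: IHn; exact: ltnW.
  by rewrite ler_pM2l //; apply: ler_sum => r _; exact: IHL.
(* With l = 0 the first edge must be dashed; the terms with l > 0 also receive the solid sum,
   shifted by one through the factor [s]. *)
rewrite big_ord_recl [X in _ <= X + _]big_ord_recl -addrA; apply: lerD.
  rewrite -mulr_suml ler_pM2r ?exprn_gt0 // -natr_sum ler_nat.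
  by have := npathsS p 0; rewrite addn0.
rewrite mulr_sumr -big_split /=; apply: ler_sum => l _.
rewrite -!mulr_suml [X in _ <= _ + X]mulrCA -exprS -mulrDl.
rewrite ler_pM2r ?exprn_gt0 // -!natr_sum -natrD ler_nat.
exact: npathsS.
Qed.

End PathBound.

(** * The Weingarten function *)

(** Bounded sums of absolute values force convergence, so that [limn] is a genuine limit, and the
    limit stays in the closed interval from -c to c. *)
Lemma normr_lim_series_le (R : realType) (u : R^nat) (c : R) :
  (forall L, \sum_(l < L) `|u l| <= c) -> `|limn (series u)| <= c.
Proof.
move=> le_c.
have seriesE (v : R^nat) L : series v L = \sum_(l < L) v l.
  by rewrite /series /= big_mkord.
have cu : cvgn (series u).
  apply: normed_cvg; rewrite -[X in cvgn X]/(series (fun l => `|u l|)).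
  apply: nondecreasing_is_cvgn.
    by apply/nondecreasing_seqP => L; rewrite !seriesE big_ord_recr /= lerDl.
  by exists c => _ [L _ <-]; rewrite seriesE.
have le_cL L : `|series u L| <= c.
  by rewrite seriesE; apply: le_trans (ler_norm_sum _ _ _) (le_c L).
rewrite ler_norml; apply/andP; split.
  apply: limr_ge => //; near=> L.
  by have := le_cL L; rewrite ler_norml => /andP[].
apply: limr_le => //; near=> L.
by have := le_cL L; rewrite ler_norml => /andP[].
Unshelve. all: by end_near.
Qed.

(** Induction through (1 + t x) (1 - t x - t y) <= 1 - t y. *)
Lemma prod_1D_le (R : realFieldType) (t : R) (r : seq nat) : 0 <= t ->
  (\prod_(k <- r) (1 + t * k%:R)) * (1 - t * (\sum_(k <- r) k)%:R) <= 1.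
Proof.
move=> t0; elim: r => [|k r IH]; first by rewrite !big_nil mulr0 subr0 mulr1.
rewrite !big_cons natrD; apply: le_trans IH.
set P := \prod_(_ <- _) _; have P0 : 0 <= P.
  by apply: prodr_ge0 => j _; rewrite addr_ge0 // mulr_ge0.
rewrite [leRHS]mulrC [_ * P]mulrC -mulrA [leRHS]mulrC ler_wpM2l //.
set x := _%:R; set y := _%:R.
have : 0 <= t * x * (t * y) by rewrite !mulr_ge0.
have : 0 <= t * x * (t * x) by rewrite !mulr_ge0.
lra.
Qed.

(** * Comparison of the Weingarten and Moebius functions *)

Section WeingartenBound.
Variables (R : realType) (M q : R) (n : nat).
Hypothesis M_neq0 : M != 0.
Hypotheses (q_ge0 : 0 <= q) (q2 : q ^+ 2 = n%:R).
Let s := `|M|^-1.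
Hypothesis small : 2 * 10 ^+ 6 * (n%:R * q * s) <= 1.

Let s_gt0 : 0 < s. Proof. by rewrite invr_gt0 normr_gt0. Qed.

Lemma lim_npaths_le (p : pairing n) :
  `|limn (series (fun g => (npaths p (pnorm p + g))%:R * (- M) ^- g))| <=
  \prod_(k <- coset_type p) cweight s k.
Proof.
apply: normr_lim_series_le => L.
rewrite -(@ler_pM2l _ (s ^+ pnorm p)) ?exprn_gt0 //.
have -> : s ^+ pnorm p * \prod_(k <- coset_type p) cweight s k =
    s ^+ n * pair_prod (fun k => cweight s k / s) p.
  rewrite pair_prodE big_split /= big_const_seq count_predT iter_mulr_1.
  rewrite [RHS]mulrCA mulrC; congr (_ * _).
  rewrite -[X in s ^+ X * _](subnK (size_coset_type p)) exprD -mulrA -exprMn.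
  by rewrite divff ?gt_eqF // expr1n mulr1.
apply: le_trans (npaths_sum_le s_gt0 q_ge0 q2 small p (pnorm p + L) (leqnn n)).
(* The series starts at |p| solid edges; the terms of the generating function below that are
   nonnegative and are discarded. *)
rewrite big_split_ord /= -[leLHS]add0r lerD //.
  by apply: sumr_ge0 => l _; rewrite mulr_ge0 // exprn_ge0 // ltW.
rewrite mulr_sumr; apply: ler_sum => l _.
by rewrite normrM normr_nat normfV normrX normrN -exprVn -/s exprD mulrCA.
Qed.

(** By [expr4_le] each weight is at most Cat(k - 1) (1 + 4 q s k); [prod_1D_le] bounds the product
    of the corrections because the parts k sum to at most n. *)
Lemma cweight_prod_le (p : pairing n) :
  (\prod_(k <- coset_type p) cweight s k) * (1 - 4 * (n%:R * q * s)) <=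
  \prod_(k <- coset_type p) catalan R k.-1.
Proof.
have qs0 : 0 <= 4 * q * s by rewrite !mulr_ge0 // ltW.
have c0 k : 0 < catalan R k := catalan_gt0 R k.
have P0 : 0 <= \prod_(k <- coset_type p) catalan R k.-1.
  by apply: prodr_ge0 => k _; exact: ltW.
have ltk k : k \in coset_type p -> (k <= n)%N.
  move=> kp; apply: leq_trans (sumn_coset_type p).
  by rewrite (big_rem k) //= leq_addr.
have lt1 : 0 <= 1 - 4 * (n%:R * q * s).
  rewrite subr_ge0; move: small; have : 0 <= n%:R * q * s by rewrite !mulr_ge0 // ltW.
  by move: (n%:R * q * s) => x; lra.
have step1 : \prod_(k <- coset_type p) cweight s k <=
    (\prod_(k <- coset_type p) catalan R k.-1) *
    \prod_(k <- coset_type p) (1 + 4 * q * s * k%:R).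
  rewrite -big_split /= big_seq [leRHS]big_seq; apply: ler_prod => k kp.
  rewrite (ltW (cweight_gt0 (ltW s_gt0) k)) /=.
  have := coset_type_gt0 kp; have := ltk _ kp; case: k {kp} => // k ltkn _ /=.
  have := expr4_le q_ge0 q2 ltkn; rewrite /cweight /= => le4.
  by have := ler_wpM2l (ltW s_gt0) le4; lra.
apply: le_trans (ler_wpM2r lt1 step1) _.
rewrite -[leLHS]mulrA -[leRHS]mulr1 ler_wpM2l //.
apply: le_trans (prod_1D_le (coset_type p) qs0).
rewrite ler_wpM2l //; first by apply: prodr_ge0 => j _; rewrite addr_ge0 // mulr_ge0.
rewrite lerD2l lerN2.
have -> : 4 * (n%:R * q * s) = 4 * q * s * n%:R by ring.
by rewrite ler_wpM2l // ler_nat sumn_coset_type.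
Qed.

(** Keeping [N] apart from [M] covers both M = N and M = -2N: the factor (N / |M|)^(n + |p|) is at
    most 1. *)
Lemma WgO_ratio_le (N : R) (p : pairing n) : 0 <= N -> N <= `|M| ->
  `|N ^+ (n + pnorm p) * WgO M p / moeb R p| <= (1 - 4 * (n%:R * q * s))^-1.
Proof.
move=> N0 NM; rewrite /WgO /moeb.
set L := limn _; have leL : `|L| <= _ := lim_npaths_le p.
set C := \prod_(_ <- _) _.
have C0 : 0 < C by apply: prodr_gt0 => k _; exact: catalan_gt0.
have leC := cweight_prod_le p; rewrite -/C in leC.
have lt1 : 0 < 1 - 4 * (n%:R * q * s).
  rewrite subr_gt0; move: small; have : 0 <= n%:R * q * s by rewrite !mulr_ge0 // ltW.
  by move: (n%:R * q * s) => x; lra.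
rewrite !normrM !normfV !normrM !normrX normrN1 !expr1n !mul1r.
rewrite (gtr0_norm C0) (ger0_norm N0).
rewrite ler_pdivrMr // mulrA.
apply: le_trans (_ : `|L| <= _).
  rewrite ler_piMl // ler_pdivrMr ?mul1r ?exprn_gt0 ?normr_gt0 //.
  by apply: lerXn2r; rewrite ?nnegrE.
apply: le_trans leL _; rewrite mulrC ler_pdivlMr //.
Qed.

End WeingartenBound.

Theorem theorem1p3 (R : realType) (G : compact_group) (n N : nat)
    (eps : pairing n -> bool) (hn : (1 <= n)%N) (hN : (1 <= N)%N)
    (hnN : 2 * 10 ^+ 6 * n%:R `^ (3 / 2) <= N%:R :> R) (p : pairing n) :
  N%:R ^+ (n + pnorm p) * Wg R G N eps p / moeb R p
    <= 1 / (1 - 10 ^+ 6 * n%:R `^ (3 / 2) / N%:R) ^+ 2.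
Proof.
pose q : R := Num.sqrt n%:R.
have q0 : 0 <= q by exact: sqrtr_ge0.
have q2 : q ^+ 2 = n%:R by rewrite sqr_sqrtr.
have powE : n%:R `^ (3 / 2) = n%:R * q :> R.
  rewrite (_ : 3 / 2 = 1 + 2^-1); last by field.
  rewrite powRD; last by rewrite pnatr_eq0 -lt0n hn implybT.
  by rewrite powRr1 // powR12_sqrt.
rewrite powE in hnN *.
have N0 : 0 < N%:R :> R by rewrite ltr0n.
have bound (M : R) : M != 0 -> N%:R <= `|M| ->
    `|N%:R ^+ (n + pnorm p) * WgO M p / moeb R p| <=
    1 / (1 - 10 ^+ 6 * (n%:R * q) / N%:R) ^+ 2.
  move=> M0 NM; have sN : `|M|^-1 <= N%:R^-1.
    by rewrite lef_pV2 ?posrE // normr_gt0.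
  set y := n%:R * q in hnN *.
  have y0 : 0 <= y by rewrite mulr_ge0.
  have leyN : y * `|M|^-1 <= y / N%:R by exact: ler_wpM2l.
  have yN : 2 * 10 ^+ 6 * (y / N%:R) <= 1 by rewrite mulrA ler_pdivrMr // mul1r.
  have small : 2 * 10 ^+ 6 * (y * `|M|^-1) <= 1.
    by apply: le_trans yN; rewrite ler_pM2l.
  apply: le_trans (WgO_ratio_le M0 q0 q2 small p (ltW N0) NM) _.
  rewrite -/y -mulrA.
  have t0 : 0 <= y / N%:R by rewrite mulr_ge0 // invr_ge0 ltW.
  move: (y / N%:R) t0 yN leyN => t t0 yN leyN.
  rewrite div1r lef_pV2 ?posrE; last 2 first.
  - by rewrite subr_gt0; lra.
  - by rewrite exprn_gt0 // subr_gt0; lra.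
  (* With x = 10^6 t in [0, 1], (1 - x)^2 <= 1 - x <= 1 - 4 t. *)
  have : 0 <= (10 ^+ 6 * t) * (1 - 10 ^+ 6 * t).
    by apply: mulr_ge0; lra.
  lra.
case: G => /=.
  by apply: le_trans (ler_norm _) (bound _ _ _); rewrite ?gt_eqF ?normr_nat.
apply: le_trans (ler_norm _) _.
(* The sign is pulled to the front, where the absolute value removes it, so either sign is
   allowed. *)
rewrite (_ : _ * _ / _ = (-1) ^+ eps p *
  (N%:R ^+ (n + pnorm p) * WgO (- (2 * N%:R)) p / moeb R p)); last first.
  by rewrite mulrCA !mulrA.
rewrite normrM normrX normrN1 expr1n [leLHS]mul1r.
apply: bound; first by rewrite oppr_eq0 mulf_neq0 // gt_eqF.
by rewrite normrN normrM !normr_nat; lra.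
Qed.
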